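(* We have $d(n)=0$ for $n\le51$, and for $m\ge6$, $$d(\Theta_m)=d\big([\Theta_{m-3},\Theta_{m-2},\Theta_{m-1}]\big)+[\underbrace{0,\ldots,0}_{\frac{-t_{m-1}+5t_{m-3}+1}{2}},\underbrace{1,\ldots,1}_{\frac{t_{m-1}-3t_{m-3}-1}{2}},\underbrace{0,\ldots,0}_{t_{m-1}+t_{m-2}}].$$
   Context: The Tribonacci substitution $\sigma$ on the alphabet $\{a,b,c\}$ is $\sigma(a)=ab$, $\sigma(b)=ac$, $\sigma(c)=a$. The Tribonacci sequence $\mathbb{T}$ is the infinite word that is the fixed point of $\sigma$ beginning with $a$; $\mathbb{T}[1,n]$ is its prefix of length $n$. Put $T_{-2}=\epsilon$ (empty word), $T_{-1}=c$, $T_m=\sigma^m(a)$ for $m\ge0$, $t_m=|T_m|$ for $m\ge-2$, and $t_{-3}=0$; thus $t_{-3}=t_{-2}=0$, $t_{-1}=t_0=1$, $t_1=2$, $t_2=4$, $t_3=7$, $t_4=13$, and $t_m=t_{m-1}+t_{m-2}+t_{m-3}$ for $m\ge1$. For a non-empty factor $\omega$ of $\mathbb{T}$ and $p\ge1$, $\omega_p$ is the position in $\mathbb{T}$ of the last letter of the $p$-th occurrence of $\omega$. Write $\nu\triangleright\omega$ if $\nu$ is a suffix of $\omega$. Let $D(n)=\#\{(\omega,p)\mid\omega\text{ non-empty},\ p\ge1,\ \omega\omega\omega\triangleright\mathbb{T}[1,\omega_{p+2}],\ \omega_{p+2}\le n\}$ for $n\ge0$ (number of repeated cubes in $\mathbb{T}[1,n]$)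 and $d(n)=D(n)-D(n-1)$ for $n\ge1$. For $m\ge0$, $\Theta_m=\{i+\frac{t_{m+1}+t_{m-1}-3}{2}: 1\le i\le t_m\}$, an interval of $t_m$ consecutive positive integers; these are consecutive intervals partitioning the positive integers, and $[\Theta_{m-3},\Theta_{m-2},\Theta_{m-1}]$ denotes the union, an interval of $t_m$ integers. For an interval $\{x,\ldots,y\}$ of positive integers, $d(\{x,\ldots,y\})$ denotes the vector $[d(x),d(x+1),\ldots,d(y)]$. Vectors of the same length are added entrywise; the number under a brace is the number of repeated entries. *)

(* Defs.v *)
From HB Require Import structures.
From mathcomp Require Import all_boot all_order all_algebra.
From mathcomp Require Import finmap zify.
From mathcomp Require Import boolp classical_sets functions cardinality.

Set Implicit Arguments.
Unset Strict Implicit.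
Unset Printing Implicit Defensive.

Import Order.TTheory GRing.Theory Num.Theory.

Local Open Scope nat_scope.

Inductive letter := La | Lb | Lc.

Definition letter_code (x : letter) : 'I_3 :=
  match x with La => inord 0 | Lb => inord 1 | Lc => inord 2 end.
Definition letter_decode (i : 'I_3) : letter := nth La [:: La; Lb; Lc] i.
Lemma letter_codeK : cancel letter_code letter_decode.
Proof. by case; rewrite /letter_decode /= inordK. Qed.
HB.instance Definition _ := Countable.copy letter (can_type letter_codeK).

Definition sigma1 (x : letter) : seq letter :=
  match x with La => [:: La; Lb] | Lb => [:: La; Lc] | Lc => [:: La] end.
Definition sigma (w : seq letter) : seq letter := flatten (map sigma1 w).

(* The limit of the words [sigma^m(a)], each of which is a prefix of the next
   and has length greater than [m]. By [trib_fixed] and [trib_unique] below it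
   is the unique fixed point of [sigma] beginning with [a]. The letter at
   position [n >= 1] of the infinite word is [trib n.-1]. *)
Definition trib (i : nat) : letter := nth La (iter i.+1 sigma [:: La]) i.

Definition trib_prefix (n : nat) : seq letter := mkseq trib n.

(* [T_m]; it is also empty for [m <= -3], so that [t (-3) = 0]. *)
Definition T (m : int) : seq letter :=
  match m with
  | Posz k => iter k sigma [:: La]
  | Negz 0 => [:: Lc]
  | Negz _ => [::]
  end.
Definition t (m : int) : nat := size (T m).
Arguments T m%_ring_scope.
Arguments t m%_ring_scope.

(* A non-empty word occurs in the infinite word with last letter at position
   [j] iff it is a suffix of the prefix of length [j]. Hence [occ_pos w p j],
   for non-empty [w] and [p >= 1], reads [w_p = j]; this is a relation because
   [w_p] only exists when [w] is a factor. *)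
Definition occ_pos (w : seq letter) (p j : nat) : Prop :=
  suffix w (trib_prefix j) /\
  count (fun i => suffix w (trib_prefix i)) (iota 1 j) = p.

Definition repeated_cubes (n : nat) : set (seq letter * nat) :=
  [set wp | let: (w, p) := wp in
     [/\ w <> [::], 1 <= p
       & exists j, [/\ occ_pos w p.+2 j,
                       suffix (w ++ w ++ w) (trib_prefix j)
                     & j <= n]]]%classic.

(* [fset_set] is the empty set on infinite sets; see [finite_repeated_cubes]. *)
Definition D (n : nat) : nat := #|` fset_set (repeated_cubes n)|%fset.

(* Only meaningful for [n >= 1]. *)
Definition d (n : nat) : int := ((D n)%:Z - (D n.-1)%:Z)%R.

(* Meaningful for [m >= 0], where the truncated subtraction and the halving are
   exact, see [Theta_exact]. *)
Definition Theta (m : int) : seq nat :=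
  [seq i + (t (m + 1) + t (m - 1) - 3)./2 | i <- iota 1 (t m)].
Arguments Theta m%_ring_scope.

(* Used on vectors of equal lengths only, see [size_vectors]. *)
Definition vadd (u v : seq int) : seq int :=
  [seq (x.1 + x.2)%R | x <- zip u v].

Lemma sigma_cat u v : sigma (u ++ v) = sigma u ++ sigma v.
Proof. by rewrite /sigma map_cat flatten_cat. Qed.

Lemma iter_sigma_cat m u v :
  iter m sigma (u ++ v) = iter m sigma u ++ iter m sigma v.
Proof. by elim: m => //= m ->; rewrite sigma_cat. Qed.

Lemma iter_sigmaS m :
  iter m.+1 sigma [:: La] = iter m sigma [:: La] ++ iter m sigma [:: Lb].
Proof. by rewrite iterSr -iter_sigma_cat. Qed.

Lemma size_sigma w : size w <= size (sigma w).
Proof. by elim: w => //= -[] w IH; rewrite /sigma /= -/(sigma _); lia. Qed.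

Lemma size_iter_sigma m : m < size (iter m sigma [:: La]).
Proof.
elim: m => // m IH; rewrite iter_sigmaS size_cat.
suff: 0 < size (iter m sigma [:: Lb]) by lia.
by elim: m {IH} => // m /leq_trans; apply; apply: size_sigma.
Qed.

Lemma nth_iter_sigma m k i : i < size (iter m sigma [:: La]) ->
  nth La (iter (m + k) sigma [:: La]) i = nth La (iter m sigma [:: La]) i.
Proof.
move=> im; elim: k => [|k IH]; first by rewrite addn0.
rewrite addnS iter_sigmaS nth_cat IH ifT //.
elim: k {IH} => [|k IH]; first by rewrite addn0.
by rewrite addnS (leq_trans IH)//= size_sigma.
Qed.

Lemma trib_iter m i : i < size (iter m sigma [:: La]) ->
  trib i = nth La (iter m sigma [:: La]) i.
Proof.
move=> im; rewrite /trib; have [le|/ltnW le] := leqP m i.+1.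
  by rewrite -(subnKC le) nth_iter_sigma.
rewrite -[in RHS](subnKC le) nth_iter_sigma//.
exact: leq_trans (size_iter_sigma _).
Qed.

Lemma trib_prefix_iter m n : n <= size (iter m sigma [:: La]) ->
  trib_prefix n = take n (iter m sigma [:: La]).
Proof.
move=> nm; apply: (@eq_from_nth _ La) => [|i].
  by rewrite size_mkseq size_takel.
rewrite size_mkseq => ilt; rewrite nth_mkseq// nth_take//.
by apply: trib_iter; apply: leq_trans nm.
Qed.

(* [sigma (u) = u] for an infinite word [u]. *)
Definition sigma_fixed (u : nat -> letter) : Prop :=
  forall n, sigma (mkseq u n) = mkseq u (size (sigma (mkseq u n))).

Lemma trib_fixed : trib 0 = La /\ sigma_fixed trib.
Proof.
split=> // n; rewrite -/(trib_prefix n) -/(trib_prefix _).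
have [m nm] : exists m, n <= size (iter m sigma [:: La]).
  by exists n; apply: ltnW (size_iter_sigma n).
rewrite (trib_prefix_iter nm).
have E : iter m.+1 sigma [:: La] =
    sigma (take n (iter m sigma [:: La])) ++
    sigma (drop n (iter m sigma [:: La])).
  by rewrite -sigma_cat cat_take_drop.
rewrite (@trib_prefix_iter m.+1); last by rewrite E size_cat leq_addr.
by rewrite E take_size_cat.
Qed.

Lemma trib_unique (u : nat -> letter) :
  u 0 = La -> sigma_fixed u -> u =1 trib.
Proof.
move=> u0 uf i; rewrite /trib.
have P m : iter m sigma [:: La] = mkseq u (size (iter m sigma [:: La])).
  elim: m => [|m IH]; first by rewrite /= /mkseq /= u0.
  by rewrite iterS {1}IH uf -IH.
rewrite [X in nth _ X _]P nth_mkseq//; exact: ltnW (size_iter_sigma i.+1).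
Qed.

Lemma occ_pos_inj w p j k : w <> [::] ->
  occ_pos w p j -> occ_pos w p k -> j = k.
Proof.
move=> w0; wlog lt : j k / j < k => [H oj ok|].
  by case: (ltngtP j k) => // /H; [exact | move=> -> //].
move=> [_ cj] [sk ck]; move: ck.
have -> : iota 1 k = iota 1 j ++ iota j.+1 (k - j.+1) ++ [:: k].
  rewrite (_ : iota 1 k = iota 1 (j + (k - j.+1 + 1))); last first.
    by congr iota; move: lt; clear; lia.
  rewrite !iotaD /= add1n (_ : j.+1 + _ = k) //; move: lt; clear; lia.
by rewrite !count_cat cj /= sk; clear; lia.
Qed.

Lemma finite_repeated_cubes n : finite_set (repeated_cubes n).
Proof.
set words := [seq drop k (trib_prefix j) | j <- iota 0 n.+1, k <- iota 0 n.+1].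
apply: (@sub_finite_set _ _
  [set` [seq (w, p) | w <- words, p <- iota 0 n.+1]]%classic);
  last exact: finite_seq.
move=> [w p] [_ _ [j [[sj cj] _ jn]]].
have [v vE] := suffixP sj.
change ((w, p) \in [seq (w, p) | w <- words, p <- iota 0 n.+1]).
apply: (allpairs_f (fun w p => (w, p))); last first.
  have := count_size (fun i => suffix w (trib_prefix i)) (iota 1 j).
  by rewrite cj size_iota mem_iota; move: jn; clear; lia.
have -> : w = drop (size v) (trib_prefix j) by rewrite vE drop_size_cat.
apply: (allpairs_f (fun j k => drop k (trib_prefix j))).
  by rewrite mem_iota.
have := congr1 size vE; rewrite size_cat size_mkseq mem_iota.
by move: jn; clear; lia.
Qed.

Lemma t_rec (m : int) : (1 <= m)%R ->
  t m = t (m - 1) + t (m - 2) + t (m - 3).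
Proof.
case: m => [[|[|[|k]]]|] // _.
rewrite (_ : Posz k.+3 - 1 = k.+2)%R; last by lia.
rewrite (_ : Posz k.+3 - 2 = k.+1)%R; last by lia.
rewrite (_ : Posz k.+3 - 3 = k)%R; last by lia.
rewrite /t /T iter_sigmaS size_cat -addnA; congr addn.
rewrite iterSr (iter_sigma_cat _ [:: La] [:: Lc]) size_cat; congr addn.
by rewrite iterSr.
Qed.

Lemma t_rec_nat (k : nat) : t k.+3 = t k.+2 + t k.+1 + t k.
Proof.
have := @t_rec k.+3 isT.
rewrite (_ : Posz k.+3 - 1 = k.+2)%R; last by lia.
rewrite (_ : Posz k.+3 - 2 = k.+1)%R; last by lia.
by rewrite (_ : Posz k.+3 - 3 = k)%R; last by lia.
Qed.

Lemma t_lt (k : nat) : t k < t k.+1.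
Proof.
rewrite /t /T iter_sigmaS size_cat -[X in X < _]addn0 ltn_add2l.
by elim: k => // k /leq_trans; apply; apply: size_sigma.
Qed.

Lemma t_odd (k : nat) : odd (t k.+2 + t k).
Proof.
suff [] : odd (t k.+2 + t k) /\ odd (t k.+3 + t k.+1) by [].
elim: k => [|k [o1 o2]] //; split=> //; move: o1 o2.
rewrite (t_rec_nat k.+1) (t_rec_nat k); lia.
Qed.

Lemma Theta_exact (m : int) : (0 <= m)%R ->
  3 <= t (m + 1) + t (m - 1) /\ ~~ odd (t (m + 1) + t (m - 1) - 3).
Proof.
case: m => [[|k]|] // _.
rewrite (_ : Posz k.+1 + 1 = k.+2)%R; last by lia.
rewrite (_ : Posz k.+1 - 1 = k)%R; last by lia.
have pos : 0 < t k by exact: leq_trans (size_iter_sigma k).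
by have [[o l1] l2] := (t_odd k, t_lt k, t_lt k.+1); split; lia.
Qed.

(* The truncated subtractions and the halvings in [propositiond] are exact. *)
Lemma braces_exact (m : int) : (6 <= m)%R ->
  [/\ t (m - 1) <= 5 * t (m - 3) + 1,
      ~~ odd (5 * t (m - 3) + 1 - t (m - 1)),
      3 * t (m - 3) + 1 <= t (m - 1)
    & ~~ odd (t (m - 1) - (3 * t (m - 3) + 1))].
Proof.
case: m => [[|[|[|[|[|[|k]]]]]]|] // _.
rewrite (_ : Posz k.+3.+3 - 3 = k.+3)%R; last by lia.
rewrite (_ : Posz k.+3.+3 - 1 = k.+3.+2)%R; last by lia.
have := (t_odd k, t_lt k, t_lt k.+1).
rewrite (t_rec_nat k.+2) (t_rec_nat k.+1) (t_rec_nat k) => -[[o l1] l2].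
by split; lia.
Qed.

Lemma size_vectors (m : int) : (6 <= m)%R ->
  size (Theta m) = size (Theta (m - 3) ++ Theta (m - 2) ++ Theta (m - 1)) /\
  size (Theta m) = (5 * t (m - 3) + 1 - t (m - 1))./2 +
    (t (m - 1) - 3 * t (m - 3) - 1)./2 + (t (m - 1) + t (m - 2)).
Proof.
move=> m6; have [l1 o1 l2 o2] := braces_exact m6.
rewrite !size_cat !size_map !size_iota t_rec; last by lia.
by split; lia.
Qed.

Lemma Theta_iota (m : int) :
  Theta m = iota ((t (m + 1) + t (m - 1) - 3)./2.+1) (t m).
Proof. by rewrite -addn1 iotaDl; apply: eq_map => i; rewrite addnC. Qed.

(* Concatenating consecutive [Theta]s lists their union in increasing order. *)
Lemma Theta_concat (m : int) : (3 <= m)%R ->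
  Theta (m - 3) ++ Theta (m - 2) ++ Theta (m - 1) =
  iota ((t (m - 2) + t (m - 4) - 3)./2.+1) (t m).
Proof.
move=> m3; rewrite !Theta_iota.
have e0 : t m = t (m - 1) + t (m - 2) + t (m - 3) by rewrite t_rec; lia.
have [le _] := @Theta_exact (m - 3)%R ltac:(lia); move: le.
have e1 : t (m - 1) = t (m - 2) + t (m - 3) + t (m - 4).
  rewrite t_rec; last by lia.
  by congr (t _ + t _ + t _); lia.
rewrite (_ : m - 3 + 1 = m - 2)%R; last by lia.
rewrite (_ : m - 3 - 1 = m - 4)%R; last by lia.
rewrite (_ : m - 2 + 1 = m - 1)%R; last by lia.
rewrite (_ : m - 2 - 1 = m - 3)%R; last by lia.
rewrite (_ : m - 1 + 1 = m)%R; last by lia.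
rewrite (_ : m - 1 - 1 = m - 2)%R; last by lia.
move=> le; rewrite [in RHS](_ : t m = t (m - 3) + (t (m - 2) + t (m - 1))) ?iotaD; last by lia.
congr (iota _ _ ++ (iota _ _ ++ iota _ _)); rewrite ?e0; lia.
Qed.

(* Main.v *)
(* [d n] counts the periods [k] of the cubes that end at position [n]. Every
   letter [a] begins a block [ab], [ac] or [a], so two equal factors at
   different positions desubstitute, at the cost of the one letter [a] that
   begins every block. Iterating down to the empty word puts any two equal
   factors of the word inside two copies of
   [U_m = sigma^(m-1)(a) ... sigma(a) a], each following a boundary between
   [sigma^m]-blocks. Comparing lengths, in a cube the two boundaries delimit
   the image [sigma^m(c)] of a single letter [c]: the period is [t_(m-1)], and
   the position of the cube is known up to an offset.
   Since [Theta_m] is the interval from [|U_m| + 1] to [|U_m| + t_m], and [U_m]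
   occurs both at the beginning of the word and after [t_m] letters, shifting by
   [t_m] preserves the cubes, except for those that begin before position [t_m];
   these all come from the first letter [c] and the level [m - 2]. *)
Require Import Defs.
From mathcomp Require Import all_boot all_order all_algebra.
From mathcomp Require Import finmap zify.
From mathcomp Require Import classical_sets cardinality.
Import Order.TTheory GRing.Theory Num.Theory.

Set Implicit Arguments.
Unset Strict Implicit.
Unset Printing Implicit Defensive.

Local Open Scope nat_scope.

(** * Factors and block boundaries *)

Definition factor (x l : nat) : seq letter := mkseq (fun j => trib (x + j)) l.

Lemma size_factor x l : size (factor x l) = l.
Proof. exact: size_mkseq. Qed.

Lemma factor1 x : factor x 1 = [:: trib x].
Proof. by rewrite /factor /mkseq /= addn0. Qed.

Lemma factor_prefix l : factor 0 l = trib_prefix l.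
Proof. by []. Qed.

Lemma factor_cat x l1 l2 : factor x (l1 + l2) = factor x l1 ++ factor (x + l1) l2.
Proof.
rewrite /factor /mkseq iotaD map_cat add0n; congr cat.
rewrite -[X in iota X _]addn0 iotaDl -map_comp.
by apply: eq_map => j /=; rewrite addnA.
Qed.

Lemma prefix_cat x l : trib_prefix (x + l) = trib_prefix x ++ factor x l.
Proof. by rewrite -!factor_prefix factor_cat. Qed.

Lemma factorP x y l :
  (forall j, j < l -> trib (x + j) = trib (y + j)) <-> factor x l = factor y l.
Proof.
split=> [H|H j jl].
  by apply/eq_in_map => j; rewrite mem_iota => /andP[_]; exact: H.
by have := congr1 (fun s => nth La s j) H; rewrite !nth_mkseq.
Qed.

(** The word is its own image under [sigma^m]; this is the index, counted from 0, at which the block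
    of [trib x] begins. *)
Definition pos (m x : nat) : nat := size (iter m sigma (trib_prefix x)).

Lemma iter_sigma_prefix m x : iter m sigma (trib_prefix x) = trib_prefix (pos m x).
Proof.
rewrite /pos; elim: m => [|m IH] /=; first by rewrite size_mkseq.
have [_ /(_ (size (iter m sigma (trib_prefix x))))] := trib_fixed.
by rewrite -!/(trib_prefix _) -IH.
Qed.

Lemma posS m x : pos m.+1 x = pos 1 (pos m x).
Proof. by rewrite /pos /= -iter_sigma_prefix. Qed.

Lemma pos0 x : pos 0 x = x.
Proof. exact: size_mkseq. Qed.

Lemma pos_0 m : pos m 0 = 0.
Proof. by rewrite /pos; elim: m => //= m /size0nil ->. Qed.

Lemma posD m x l : pos m (x + l) = pos m x + size (iter m sigma (factor x l)).
Proof. by rewrite /pos prefix_cat iter_sigma_cat size_cat. Qed.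

Lemma pos_succ m x : pos m x.+1 = pos m x + size (iter m sigma [:: trib x]).
Proof. by rewrite -addn1 posD factor1. Qed.

Lemma leq_pos m x y : x <= y -> pos m x <= pos m y.
Proof. by move=> /subnKC <-; rewrite posD leq_addr. Qed.

Lemma iter_sigma_factor m x l :
  iter m sigma (factor x l) = factor (pos m x) (size (iter m sigma (factor x l))).
Proof.
have := iter_sigma_prefix m (x + l).
rewrite prefix_cat iter_sigma_cat posD prefix_cat iter_sigma_prefix.
by move/eqP; rewrite eqseq_cat // => /andP[_ /eqP].
Qed.

(** * Desubstitution of equal factors *)

Lemma sigma1_seq x : sigma [:: x] = sigma1 x.
Proof. by rewrite /sigma /= cats0. Qed.

Lemma pos1_succ x : pos 1 x.+1 = pos 1 x + size (sigma1 (trib x)).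
Proof. by rewrite pos_succ /= sigma1_seq. Qed.

Lemma factor_pos1 x : factor (pos 1 x) (size (sigma1 (trib x))) = sigma1 (trib x).
Proof. by have := iter_sigma_factor 1 x 1; rewrite factor1 /= sigma1_seq. Qed.

Lemma trib_pos1D x e : e < size (sigma1 (trib x)) ->
  trib (pos 1 x + e) = nth La (sigma1 (trib x)) e.
Proof. by move=> es; rewrite -[in RHS]factor_pos1 nth_mkseq. Qed.

Lemma trib_pos1 x : trib (pos 1 x) = La.
Proof. by rewrite -[pos 1 x]addn0 trib_pos1D; case: (trib x). Qed.

(** After a one-letter block the next block opens with [a], which is the default value of [nth].
    Thus this letter alone identifies [trib x]. *)
Lemma trib_pos1S x : trib (pos 1 x).+1 = nth La (sigma1 (trib x)) 1.
Proof.
have [lt|ge] := ltnP 1 (size (sigma1 (trib x))).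
  by rewrite -trib_pos1D // addn1.
rewrite nth_default //; have := trib_pos1 x.+1; rewrite pos1_succ.
by move: ge; case: (trib x) => //= _; rewrite addn1.
Qed.

Lemma pos1_block i : exists x e, i = pos 1 x + e /\ e < size (sigma1 (trib x)).
Proof.
elim: i => [|i [x [e [-> es]]]].
  by exists 0, 0; split=> //; case: (trib 0).
have [lt|ge] := ltnP e.+1 (size (sigma1 (trib x))).
  by exists x, e.+1; rewrite addnS.
exists x.+1, 0; split; last by case: (trib x.+1).
by rewrite pos1_succ; lia.
Qed.

Lemma leq_pos1 x : x <= pos 1 x.
Proof. by rewrite -{1}(size_mkseq trib x) size_sigma. Qed.

(* The images of distinct letters share their first letter but not the next. *)
Lemma desubst_aligned x y l : 0 < l -> factor (pos 1 x) l = factor (pos 1 y) l ->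
  exists l', [/\ factor x l' = factor y l', x + l' < pos 1 x + l
               & l <= (size (sigma (factor x l'))).+1].
Proof.
elim/ltn_ind: l x y => l IH x y l0 /factorP eqxy.
case: (posnP l.-1) => [l1|l1].
  by exists 0; split=> //; have := leq_pos1 x; lia.
have Txy : trib x = trib y.
  have := eqxy 1 ltac:(lia); rewrite !addn1 !trib_pos1S.
  by case: (trib x); case: (trib y).
have sz : 0 < size (sigma1 (trib x)) <= 2 by case: (trib x).
case: (posnP (l - size (sigma1 (trib x)))) => [l2|l2].
  exists 1; rewrite !factor1 Txy sigma1_seq -Txy; split=> //; last lia.
  by have := leq_pos1 x; lia.
have [|||l' [e1 e2 e3]] := IH (l - size (sigma1 (trib x))) _ x.+1 y.+1; try lia.
  apply/factorP => j jl; have := eqxy (size (sigma1 (trib x)) + j) ltac:(lia).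
  by rewrite !pos1_succ -Txy !addnA.
exists l'.+1; split.
- by rewrite -(add1n l') !factor_cat !factor1 Txy !addn1 e1.
- by move: e2; rewrite pos1_succ; lia.
- rewrite -(add1n l') factor_cat sigma_cat size_cat factor1 sigma1_seq addn1.
  by lia.
Qed.

(** A first letter [a] means offset 0, while [b] or [c] means offset 1 in a known block, so both
    factors start at the same offset. The bound [x + l' < i + l] makes iteration terminate. *)
Lemma desubst i i' l : 0 < l -> factor i l = factor i' l ->
  exists x y e l', [/\ i = pos 1 x + e, i' = pos 1 y + e,
    factor x l' = factor y l', x + l' < i + l
    & e + l <= (size (sigma (factor x l'))).+1].
Proof.
move=> l0 /factorP eqi.
have [x [e [ix ex]]] := pos1_block i; have [y [e' [iy ey]]] := pos1_block i'.
have [ee exy] : e = e' /\ (0 < e -> trib x = trib y).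
  have := eqi 0 l0; rewrite !addn0 ix iy !trib_pos1D //.
  by move: e e' ex ey {ix iy} => [|[|e]] [|[|e']]; case: (trib x); case: (trib y).
subst e' i i'.
have [|l' [e1 e2 e3]] := @desubst_aligned x y (e + l) ltac:(lia).
  apply/factorP => j jl; have [je|je] := ltnP j e.
    rewrite !trib_pos1D; first by rewrite exy //; lia.
      by lia.
    by lia.
  have := eqi (j - e) ltac:(lia).
  by rewrite -!addnA subnKC.
by exists x, y, e, l'; split=> //; lia.
Qed.

(* [sigma^(m-1)(a) ... sigma(a) a], the longest word that necessarily follows
   every boundary between [sigma^m]-blocks. *)
Fixpoint block_head (m : nat) : seq letter :=
  if m is k.+1 then rcons (sigma (block_head k)) La else [::].

Definition head_len (m : nat) : nat := size (block_head m).

Lemma factor_block_head m x : factor (pos m x) (head_len m) = block_head m.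
Proof.
rewrite /head_len; elim: m => //= m IH; rewrite size_rcons posS.
have E := iter_sigma_factor 1 (pos m x) (size (block_head m)).
have P := posD 1 (pos m x) (size (block_head m)).
rewrite IH /= in E P.
by rewrite -[(size _).+1]addn1 factor_cat factor1 -P trib_pos1 -E cats1.
Qed.

(** The head also unfolds at its front, as [sigma^m(a)] followed by [block_head m]. *)
Lemma head_lenS m : head_len m.+1 = t m + head_len m.
Proof.
rewrite /head_len /t /T -size_cat; congr size.
elim: m => //= m IH; rewrite -rcons_cat -sigma_cat; congr (rcons (sigma _) _).
exact: IH.
Qed.

Lemma desubst_iter i i' l : factor i l = factor i' l ->
  exists m x y e, [/\ i = pos m x + e, i' = pos m y + e & e + l <= head_len m].
Proof.
have [N] := ubnP (i + l); elim: N i i' l => // N IH i i' l lN.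
case: (posnP l) => [-> _|l0 /(desubst l0)].
  by exists 0, i, i', 0; rewrite !pos0 !addn0.
move=> [x1 [y1 [e1 [l1 [iE i'E eq1 lt1 le1]]]]].
have [|m [x [y [e [xE yE le]]]]] := IH _ _ _ _ eq1; first lia.
have hx := factor_block_head m x; have hy := factor_block_head m y.
(* Both boundaries are followed by [block_head m], so the image of the [e] letters skipped is the
   same on both sides. *)
have pE z : pos 1 (pos m z + e) = pos m.+1 z + size (sigma (take e (block_head m))).
  rewrite posD -posS; congr addn; rewrite -(factor_block_head m z) /=.
  have -> : head_len m = e + (head_len m - e) by lia.
  by rewrite factor_cat take_size_cat ?size_factor.
exists m.+1, x, y, (size (sigma (take e (block_head m))) + e1).
rewrite iE i'E xE yE !pE !addnA; split=> //.
rewrite -addnA; apply: leq_trans (leq_add (leqnn _) le1) _.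
(* The last [a] of [block_head m.+1] absorbs the extra letter in [le1]. *)
rewrite /head_len /= size_rcons -[in X in _ <= X](cat_take_drop e (block_head m)).
rewrite sigma_cat size_cat addnS ltnS leq_add2l.
have -> : drop e (block_head m) = factor x1 l1 ++ factor (x1 + l1) (head_len m - e - l1).
  rewrite -factor_cat -hx xE.
  have {1}-> : head_len m = e + (head_len m - e) by lia.
  rewrite factor_cat drop_size_cat ?size_factor //.
  by congr factor; lia.
by rewrite sigma_cat size_cat leq_addr.
Qed.

(** * Block lengths and the location of cubes *)

Definition block_len (m : nat) (x : letter) : nat := size (iter m sigma [:: x]).

Lemma block_len_aS m : block_len m.+1 La = block_len m La + block_len m Lb.
Proof. by rewrite /block_len iterSr -size_cat -iter_sigma_cat. Qed.

Lemma block_len_bS m : block_len m.+1 Lb = block_len m La + block_len m Lc.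
Proof. by rewrite /block_len iterSr -size_cat -iter_sigma_cat. Qed.

Lemma block_len_cS m : block_len m.+1 Lc = block_len m La.
Proof. by rewrite /block_len iterSr. Qed.

Definition block_lenS := (block_len_aS, block_len_bS, block_len_cS).

Lemma t_block_len (m : nat) : t m = block_len m La.
Proof. by []. Qed.

Lemma block_len_bounds m :
  [/\ 0 < block_len m Lc, block_len m Lc <= block_len m Lb,
      block_len m Lb <= block_len m La & block_len m La <= 2 * block_len m Lb].
Proof. by elim: m => // m [b1 b2 b3 b4]; rewrite !block_lenS; split; lia. Qed.

(** From one level to the next the head gains [t m], and the three lengths together gain twice as
    much. *)
Lemma head_len_blocks m :
  2 * head_len m + 3 = block_len m La + block_len m Lb + block_len m Lc.
Proof.
by elim: m => // m IH; rewrite head_lenS t_block_len !block_lenS; lia.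
Qed.

(* The [3 * k] letters from index [i] (counted from [0]) have period [k]. *)
Definition cube (i k : nat) : bool := factor i (2 * k) == factor (i + k) (2 * k).

Lemma trib_after_c x : trib x = Lc -> trib x.+1 = La.
Proof.
have [y [e [-> es]]] := pos1_block x; rewrite trib_pos1D // => T.
have -> : (pos 1 y + e).+1 = pos 1 y.+1; last exact: trib_pos1.
by rewrite pos1_succ; move: es T; case: (trib y) e => [] [|[|e]] //=; lia.
Qed.

(** A cube gives equal factors of length [2 * k] at distance [k] inside two heads, so [4 * k] is
    less than the sum of the three block lengths. This leaves no room between the boundaries for a
    block of [a] or [b], hence room for only one block of [c], as [a] follows [c]. *)
Lemma cube_block i k : 0 < k -> cube i k ->
  exists m x e, [/\ trib x = Lc, k = block_len m Lc, i = pos m x + e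
                  & e + 2 * k <= head_len m].
Proof.
move=> k0 /eqP/desubst_iter[m [x [y [e [iE ikE le]]]]].
have [b1 b2 b3 b4] := block_len_bounds m; have hl := head_len_blocks m.
have ltxy : x < y.
  by rewrite ltnNge; apply/negP => /(leq_pos m); lia.
have /(leq_pos m) ley := ltxy; move: ley; rewrite pos_succ -/(block_len m _) => ley.
have Tx : trib x = Lc by move: ley; case: (trib x) => // ley; lia.
exists m, x, e; split=> //.
have [/(leq_pos m)|yx] := ltnP x.+1 y.
  by rewrite !pos_succ (trib_after_c Tx) -!/(block_len m _); lia.
have yE : y = x.+1 by lia.
by move: ikE; rewrite yE pos_succ Tx -/(block_len m _); lia.
Qed.

Lemma factor_head m x j l : j + l <= head_len m ->
  factor (pos m x + j) l = take l (drop j (block_head m)).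
Proof.
move=> le; rewrite -(factor_block_head m x).
have -> : head_len m = j + (l + (head_len m - j - l)) by lia.
rewrite factor_cat drop_size_cat ?size_factor //.
by rewrite factor_cat take_size_cat ?size_factor.
Qed.

Lemma block_cube m x e : trib x = Lc -> e + 2 * block_len m Lc <= head_len m ->
  cube (pos m x + e) (block_len m Lc).
Proof.
move=> Tx le; apply/eqP.
have -> : pos m x + e + block_len m Lc = pos m x.+1 + e.
  by rewrite pos_succ Tx addnAC.
by rewrite !factor_head.
Qed.

(* [0] and [t m] are boundaries between [sigma^m]-blocks, hence are both followed
   by [block_head m]. *)
Lemma cube_shift m i k : i + 3 * k <= head_len m -> cube (i + t m) k = cube i k.
Proof.
have shift j l : j + l <= head_len m -> factor (j + t m) l = factor j l.
  move=> le; have := factor_head 0 le; have := factor_head 1 le.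
  by rewrite pos_succ pos_0 add0n addnC => -> ->.
move=> le; by rewrite /cube (addnAC i) !shift //; lia.
Qed.

(** * Repeated cubes counted by their periods *)

Lemma suffix_prefixP (w : seq letter) j :
  reflect (size w <= j /\ w = factor (j - size w) (size w)) (suffix w (trib_prefix j)).
Proof.
apply: (iffP idP) => [sw|[le ->]].
  have le : size w <= j by have := size_suffix sw; rewrite size_mkseq.
  split=> //; move: sw; rewrite -{1}(subnK le) prefix_cat suffixE.
  by rewrite size_cat size_factor addnK drop_size_cat ?size_mkseq // => /eqP.
by rewrite -{2}(subnK le) prefix_cat suffix_suffix.
Qed.

Definition cube_ends (n k : nat) : bool := (3 * k <= n) && cube (n - 3 * k) k.

Lemma cube_endsP n (w : seq letter) :
  reflect (cube_ends n (size w) /\ w = factor (n - size w) (size w))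
          (suffix (w ++ w ++ w) (trib_prefix n)).
Proof.
set k := size w.
have split3 : 3 * k <= n -> factor (n - 3 * k) (3 * k) =
    factor (n - 3 * k) k ++ factor (n - 2 * k) k ++ factor (n - k) k.
  move=> le; rewrite (_ : 3 * k = k + (k + k)) ?factor_cat; last by lia.
  by congr (_ ++ (factor _ _ ++ factor _ _)); lia.
have cubeE : 3 * k <= n -> cube (n - 3 * k) k =
    (factor (n - 3 * k) k == factor (n - 2 * k) k) &&
    (factor (n - 2 * k) k == factor (n - k) k).
  move=> le; rewrite /cube mul2n -addnn !factor_cat eqseq_cat ?size_factor //.
  by congr ((factor _ _ == factor _ _) && (factor _ _ == factor _ _)); lia.
have sz : size (w ++ w ++ w) = 3 * k by rewrite !size_cat /k; lia.
apply: (iffP (suffix_prefixP _ _)); rewrite sz /cube_ends.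
  case=> le; rewrite split3 // le cubeE // => /eqP.
  rewrite !eqseq_cat ?size_factor //= => /and3P[/eqP <- /eqP <- /eqP <-].
  by rewrite !eqxx.
case=> /andP[le]; rewrite cubeE // => /andP[/eqP e1 /eqP e2] wE.
by split=> //; rewrite split3 // e1 e2 -wE.
Qed.

Definition occ_index (w : seq letter) (n : nat) : nat :=
  count (fun i => suffix w (trib_prefix i)) (iota 1 n).

(** The three copies of [w] in the cube end at distinct positions. Hence the [.-2] in [cubes_at] is
    exact and leaves a positive [p]. *)
Lemma cube_occ_index n (w : seq letter) : w <> [::] ->
  suffix (w ++ w ++ w) (trib_prefix n) -> 2 < occ_index w n.
Proof.
move=> w0 sw; have k0 : 0 < size w by case: (w) w0.
have sz3 : size (w ++ w ++ w) = 3 * size w by rewrite !size_cat; lia.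
have le3 : 3 * size w <= n by have := size_suffix sw; rewrite sz3 size_mkseq.
have occ j : suffix w (trib_prefix (n - j * size w)) -> j < 3 ->
    n - j * size w \in [seq i <- iota 1 n | suffix w (trib_prefix i)].
  move=> sj j3; rewrite mem_filter sj mem_iota.
  by move: j {sj} j3 => [|[|[|j]]] //=; lia.
have [v vE] := suffixP sw.
have szv : size v = n - 3 * size w.
  by have := congr1 size vE; rewrite size_cat sz3 size_mkseq; lia.
have take_prefix j : j <= n -> trib_prefix j = take j (trib_prefix n).
  by move=> jn; rewrite -(subnKC jn) prefix_cat take_size_cat ?size_mkseq.
rewrite /occ_index -size_filter.
apply: (@uniq_leq_size _ [:: n - 0 * size w; n - 1 * size w; n - 2 * size w]).
  by rewrite /= !inE; lia.
move=> i; rewrite !inE => /or3P[] /eqP ->; apply: occ => //.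
- by rewrite mul0n subn0 vE !catA suffix_suffix.
- rewrite take_prefix ?leq_subr // vE !catA take_size_cat ?suffix_suffix //.
  by rewrite !size_cat szv; lia.
- rewrite take_prefix ?leq_subr // vE (catA v w) take_size_cat ?suffix_suffix //.
  by rewrite size_cat szv; lia.
Qed.

(** The end [n] and the period [k] determine the whole pair. *)
Definition cubes_at (n : nat) : seq (seq letter * nat) :=
  [seq (factor (n - k) k, (occ_index (factor (n - k) k) n).-2)
     | k <- [seq k <- iota 1 n | cube_ends n k]].

Lemma mem_cubes_at n w p :
  (w, p) \in cubes_at n <->
  [/\ w <> [::], 1 <= p, occ_pos w p.+2 n & suffix (w ++ w ++ w) (trib_prefix n)].
Proof.
split=> [/mapP[k]|[w0 p1 [sw cw] /[dup] s3 /cube_endsP[ce wE]]].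
  rewrite mem_filter mem_iota => /andP[ce /andP[k1 kn]] [wE pE].
  have szw : size w = k by rewrite wE size_factor.
  have w0 : w <> [::] by move=> w0; move: k1; rewrite -szw w0.
  have s3 : suffix (w ++ w ++ w) (trib_prefix n).
    by apply/cube_endsP; rewrite szw.
  have := cube_occ_index w0 s3; rewrite pE -wE; case oE: (occ_index w n) => [|[|q]] //.
  move=> q0; split=> //; split; last by rewrite -/(occ_index w n) oE.
  by apply: suffix_trans s3; rewrite catA suffix_suffix.
apply/mapP; exists (size w); last by rewrite -wE /occ_index cw.
rewrite mem_filter ce mem_iota /=; move: ce => /andP[le _].
by case: (w) w0 le => //= *; lia.
Qed.

Lemma uniq_cubes_at n : uniq (cubes_at n).
Proof.
rewrite map_inj_uniq ?filter_uniq ?iota_uniq // => k l [/(congr1 size)].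
by rewrite !size_factor.
Qed.

Definition cubes_upto (n : nat) : seq (seq letter * nat) :=
  flatten [seq cubes_at j | j <- iota 1 n].

Lemma cubes_uptoS n : cubes_upto n.+1 = cubes_upto n ++ cubes_at n.+1.
Proof.
by rewrite /cubes_upto -{1}(addn1 n) iotaD map_cat flatten_cat /= cats0 add1n.
Qed.

Lemma mem_cubes_upto n : repeated_cubes n = [set` cubes_upto n]%classic.
Proof.
apply/seteqP; split=> -[w p] /=.
  move=> [w0 p1 [j [oj sj jn]]]; apply/flatten_mapP; exists j; last exact/mem_cubes_at.
  rewrite mem_iota add1n ltnS jn andbT lt0n; apply/eqP => j0.
  by case: oj => /size_suffix; rewrite j0 size_mkseq leqn0 size_eq0 => /eqP.
move=> /flatten_mapP[j]; rewrite mem_iota => /andP[_ jn] /mem_cubes_at[w0 p1 oj sj].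
by split=> //; exists j; split.
Qed.

Lemma uniq_cubes_upto n : uniq (cubes_upto n).
Proof.
elim: n => // n IH; rewrite cubes_uptoS cat_uniq IH uniq_cubes_at andbT /=.
apply/hasPn => -[w p] /mem_cubes_at[w0 p1 on _].
apply/negP => /flatten_mapP[j]; rewrite mem_iota => /andP[_ jn] /mem_cubes_at[_ _ oj _].
by have := occ_pos_inj w0 on oj; lia.
Qed.

Lemma D_size n : D n = size (cubes_upto n).
Proof.
have E : fset_set (repeated_cubes n) = seq_fset tt (cubes_upto n).
  apply/fsetP => x; rewrite in_fset_set; last exact: finite_repeated_cubes.
  by rewrite seq_fsetE mem_cubes_upto; apply/idP/idP; rewrite inE.
by rewrite /D E size_seq_fset undup_id // uniq_cubes_upto.
Qed.

Lemma d_count n : 0 < n -> d n = Posz (count (cube_ends n) (iota 1 n)).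
Proof.
case: n => // n _; rewrite /d !D_size cubes_uptoS size_cat size_map size_filter.
by rewrite PoszD addrAC subrr add0r.
Qed.

(** * Position of cubes and the recurrence for [d] *)

Lemma cube_block_ends n k : 0 < k -> cube_ends n k ->
  exists m x e, [/\ trib x = Lc, k = block_len m Lc,
    n - 3 * k = pos m x + e, e + 2 * k <= head_len m & pos m x.+1 + e + 2 * k = n].
Proof.
move=> k0 /andP[le /(cube_block k0)[m [x [e [Tx kE iE el]]]]].
exists m, x, e; split=> //.
by rewrite pos_succ Tx -/(block_len m Lc) -kE; lia.
Qed.

Lemma c_gt2 x : trib x = Lc -> 3 <= x.
Proof. by case: x => [|[|[|x]]]. Qed.

Lemma leq_t : {homo (fun k : nat => t k) : k l / k <= l}.
Proof. by apply: homo_leq => // [k l n|k]; [exact: leq_trans | exact/ltnW/t_lt]. Qed.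

Lemma leq_head_len : {homo head_len : k l / k <= l}.
Proof.
by apply: homo_leq => // [k l n|k]; [exact: leq_trans | rewrite head_lenS leq_addl].
Qed.

Lemma pos_t (m k : nat) : pos m (t k) = t (m + k)%N.
Proof.
by rewrite /pos (@trib_prefix_iter k) // take_oversize // -iterD.
Qed.

Lemma d_small n : 0 < n <= 51 -> d n = 0%R.
Proof.
move=> /andP[n0 n51]; rewrite d_count // (eq_in_count (a2 := pred0)) ?count_pred0 //.
move=> k; rewrite mem_iota => /andP[k1 _]; apply/negbTE/negP.
move=> /(cube_block_ends k1)[m [x [e [/c_gt2 x3 kE _ le nE]]]].
have hl := head_len_blocks m.
(* Below level 4 the head is shorter than two periods. *)
move: m kE le nE hl => [|[|[|[|m]]]] kE le nE hl;
  try by move: kE hl; rewrite /block_len /=; lia.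
(* The word begins with [abac = T 2], so the block of any [c] ends at [t 6 = 44] or later, and two
   periods of at least [t 3 = 7] each follow. *)
have := leq_pos m.+4 (x3 : 3 < x.+1); rewrite (pos_t m.+4 2) addnC.
have := @leq_t 6 (2 + m.+4) ltac:(lia); have := @leq_t 3 m.+3 ltac:(lia).
rewrite block_len_cS -t_block_len in kE.
by rewrite (_ : t 6 = 44) // (_ : t 3 = 7) //; lia.
Qed.

Lemma head_len3 k : head_len k.+3 = head_len k + t k.+3.
Proof. by rewrite !head_lenS t_rec_nat; lia. Qed.

(** The condition [n < 3 * l] says that the cube begins within the first [t k.+3] letters. *)
Lemma crossing_cube k n l : head_len k < n <= head_len k.+3 -> 0 < l -> n < 3 * l ->
  cube_ends (n + t k.+3) l = (l == t k) && (2 * t k <= n <= head_len k.+1).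
Proof.
move=> /andP[n1 n2] l0 nl; apply/idP/idP; last first.
  move=> /andP[/eqP lE /andP[le1 le2]]; subst l.
  (* At level [k.+1] the block of the first [c], of index 3, ends exactly at [t k.+3]. *)
  have p4 : pos k.+1 4 = t k.+3 by rewrite (pos_t k.+1 2); congr t; lia.
  have := p4; rewrite pos_succ -/(block_len _ _) block_len_cS -t_block_len => p3.
  apply/andP; split; first lia.
  rewrite (_ : _ - _ = pos k.+1 3 + (n - 2 * t k)); last by lia.
  have := @block_cube k.+1 3 (n - 2 * t k) erefl.
  by rewrite block_len_cS -t_block_len; apply; lia.
move=> /(cube_block_ends l0)[m [x [e [Tx lE iE le nE]]]].
have t0 : 0 < t k.+3 by exact: leq_trans (size_iter_sigma k.+3).
have ltx : pos m x < t k.+3 by lia.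
have x3 := c_gt2 Tx.
(* At a level up to [k], [t k.+3] is a boundary, so the cube would end at most [head_len k] after
   it. *)
have [mk|mk] := leqP m k.
  have := @leq_head_len m k mk.
  have tE : t k.+3 = pos m (t (k.+3 - m)%N) by rewrite pos_t; congr t; lia.
  have [/(leq_pos m)|/(leq_pos m)] := ltnP x (t (k.+3 - m)%N); lia.
(* At a level above [k.+1], the image of [ab] already reaches [t k.+3], and every [c] comes
   later. *)
have [mE|mk1] := eqVneq m k.+1; last first.
  have := leq_pos m x3; have := @leq_t k.+3 m.+1 ltac:(lia).
  rewrite pos_succ -/(block_len _ _) (pos_t m 1) addn1; lia.
subst m.
have p4 : pos k.+1 4 = t k.+3 by rewrite (pos_t k.+1 2); congr t; lia.
have xE : x = 3.
  by apply/eqP; rewrite eqn_leq x3 andbT leqNgt; apply/negP => /(leq_pos k.+1); lia.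
rewrite block_len_cS -t_block_len in lE; subst x l.
by rewrite eqxx /=; lia.
Qed.

(** Cubes that avoid the first [t k.+3] letters are translates of those ending at [n], by
    [cube_shift]; [crossing_cube] accounts for the others. *)
Lemma d_shift k n : head_len k < n <= head_len k.+3 ->
  d (n + t k.+3) = (d n + (2 * t k <= n <= head_len k.+1)%:R)%R.
Proof.
move=> nk; have /andP[n1 n2] := nk.
have tk : 0 < t k by exact: leq_trans (size_iter_sigma k).
set b := (2 * t k <= n <= head_len k.+1).
pose cr l := (l == t k) && b.
(* When [b] holds, the period [t k] is too long for a cube ending at [n], so the two kinds of
   periods are disjoint. *)
have blt : head_len k.+1 < 3 * t k.
  rewrite head_lenS; have := head_len_blocks k; rewrite t_block_len.
  by have [] := block_len_bounds k; lia.
rewrite !d_count; try lia.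
rewrite (eq_in_count (a2 := predU (cube_ends n) cr)); last first.
  move=> l; rewrite mem_iota => /andP[l1 _] /=.
  have [nl|nl] := ltnP n (3 * l).
    by rewrite crossing_cube // /cube_ends (leqNgt (3 * l)) nl.
  rewrite [cr l](_ : _ = false) ?orbF.
    rewrite /cube_ends nl (leq_trans nl) ?leq_addr //= -addnBAC // cube_shift //.
    by rewrite subnK.
  by apply/negbTE/negP => /andP[/eqP lE ]; rewrite /b; lia.
have /eqP := count_predUI (cube_ends n) cr (iota 1 (n + t k.+3)).
rewrite (eq_count (a1 := predI _ _) (a2 := pred0)) ?count_pred0 ?addn0; last first.
  move=> l /=; apply/negbTE/negP => /andP[/andP[nl _] /andP[/eqP lE bb]].
  by move: bb; rewrite /b; lia.
move=> /eqP ->; rewrite PoszD; congr (Posz _ + _)%R.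
  rewrite iotaD count_cat [X in _ + X](_ : _ = 0) ?addn0 //.
  apply/eqP; rewrite eqn0Ngt -has_count; apply/hasPn => l; rewrite mem_iota => ln.
  by apply/negP => /andP[nl _]; lia.
rewrite /cr; case: (b); last first.
  by rewrite (eq_count (a2 := pred0)) ?count_pred0 // => l /=; rewrite andbF.
rewrite (eq_count (a2 := pred1 (t k))); last by move=> l /=; rewrite andbT.
rewrite count_uniq_mem ?iota_uniq // mem_iota.
have le := @leq_t k k.+3 ltac:(lia).
by have -> : 0 < t k < 1 + (n + t k.+3) by lia.
Qed.

(** This is [head_len_blocks]: [t (m + 1)] is the length of the blocks of [a] and [b] together, and
    [t (m - 1)] that of [c]. *)
Lemma half_t_head_len (m : nat) :
  (t (Posz m + 1) + t (Posz m - 1) - 3)./2 = head_len m.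
Proof.
have := head_len_blocks m; case: m => // m.
rewrite (_ : Posz m.+1 + 1 = m.+2)%R; last by lia.
rewrite (_ : Posz m.+1 - 1 = m)%R; last by lia.
by rewrite !t_block_len !block_lenS; lia.
Qed.

Theorem propositiond :
  (forall n : nat, (1 <= n <= 51)%N -> d n = 0%R) /\
  (forall m : int, (6 <= m)%R ->
     map d (Theta m) =
     vadd (map d (Theta (m - 3) ++ Theta (m - 2) ++ Theta (m - 1)))
          (nseq ((5 * t (m - 3) + 1 - t (m - 1))./2)%N 0%R ++
           nseq ((t (m - 1) - 3 * t (m - 3) - 1)./2)%N 1%R ++
           nseq (t (m - 1) + t (m - 2))%N 0%R)).
Proof.
split=> [n|m m6]; first exact: d_small.
have [sz1 sz2] := size_vectors m6; have [ex1 ex2 ex3 ex4] := braces_exact m6.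
have [k mE] : exists k : nat, m = k.+3 by exists `|m - 3|%N; lia.
have m3E : (m - 3 = k)%R by lia.
have m1E : (m - 1 = k.+2)%R by lia.
set A := (_ + 1 - _)./2 in sz2 *; set B := (_ - 1)./2 in sz2 *.
have AE : 2 * A + t k.+2 = 5 * t k + 1 by rewrite /A -m3E -m1E; lia.
have BE : 2 * B + (3 * t k + 1) = t k.+2 by rewrite /B -m3E -m1E; lia.
have ThE : Theta m = iota (head_len k.+3).+1 (t m).
  by rewrite Theta_iota mE half_t_head_len.
have catE : Theta (m - 3) ++ Theta (m - 2) ++ Theta (m - 1) =
    iota (head_len k).+1 (t m).
  rewrite Theta_concat; last by lia.
  by rewrite -half_t_head_len; congr (iota (t _ + t _ - 3)./2.+1 _); lia.
have szt : t m = A + B + (t (m - 1) + t (m - 2)) by rewrite -sz2 ThE size_iota.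
have szv :
  size (nseq A 0%R ++ nseq B 1%R ++ nseq (t (m - 1) + t (m - 2)) 0%R : seq int) = t m.
  by rewrite !size_cat !size_nseq szt addnA.
rewrite ThE catE; apply: (@eq_from_nth _ 0%R) => [|i].
  by rewrite /vadd !size_map size1_zip ?szv !size_map ?size_iota.
rewrite size_map size_iota => im.
rewrite /vadd (nth_map (0, 0)%R); last by rewrite size1_zip ?szv size_map size_iota.
rewrite nth_zip /=; last by rewrite szv size_map size_iota.
rewrite !(nth_map 0) ?size_iota // !nth_iota // !addSn head_len3 addnAC -addSn.
rewrite d_shift; last by rewrite head_len3; move: im; rewrite mE; lia.
congr (_ + _)%R; rewrite !nth_cat !nth_nseq !size_nseq.
have := head_len_blocks k; rewrite head_lenS.
move: AE BE; rewrite !t_block_len !block_lenS => AE BE hl.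
(* The brace lengths satisfy [A + B = t k] and [A = 2 * t k - (head_len k).+1]. *)
have -> : (2 * block_len k La <= (head_len k + i).+1 <= block_len k La + head_len k) =
    (A <= i < A + B) by lia.
have [iA|iA] //= := ltnP i A.
by rewrite ltn_subLR //; case: ltnP => // _; rewrite if_same.
Qed.
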